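(* Let $N\ge1$, $S=\{1,\dots,N\}$, $z\in\{0,\dots,N\}$. (a) Let $p\in(0,1)^N$ and let $\mathbb P(\zeta\mid Z=z)$ be the (non-degenerate) conditional Bernoulli model. Put $C=\max_{i\in S}\frac{(1+w_i)^2}{w_i}$. Then for every $\zeta\in\{0,1\}^N$ with $\sum_i\zeta_i=z$ and all $i,j\in S$, $$\|\nabla_p\mathbb P(\zeta\mid Z=z)\|^2\le\|\nabla_p\log\mathbb P(\zeta\mid Z=z)\|^2\le N\,C^2,$$ $$\mathbb E\bigl[\|\nabla_p\log\mathbb P(\zeta\mid Z=z)\|^2\bigr]=\mathrm{var}\bigl(\nabla_p\log\mathbb P(\zeta\mid Z=z)\bigr)\le\frac N4\,C^2,$$ $$\left|\frac{\partial^2\mathbb P(\zeta\mid Z=z)}{\partial p_i\,\partial p_j}\right|\le 2C^2.$$ (b) Let $p\in[0,1]^N$ (degenerate entries $p_i\in\{0,1\}$ allowed) be such that $\mathbb P(Z=z)>0$. Then there is a finite constant $\widehat C$ such that, for every $\zeta\in\{0,1\}^N$ with $\sum_i\zeta_i=z$ and all $i,j\in S$, $$\|\nabla_p\mathbb P(\zeta\mid Z=z)\|^2\le\widehat C,\qquad \mathbb E\bigl[\|\nabla_p\log\mathbb P(\zeta\mid Z=z)\|^2\bigr]\le\widehat C,\qquad \left|\frac{\partial^2\mathbb P(\zeta\mid Z=z)}{\partial p_i\,\partial p_j}\right|\le\widehat C.$$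
   Context: $w_i=\frac{p_i}{1-p_i}$ for $p_i\in[0,1)$. The conditional Bernoulli model with parameters $p$ and $z$ is the law of a vector $\zeta\in\{0,1\}^N$ with independent Bernoulli$(p_i)$ entries conditioned on $Z=\sum_i\zeta_i=z$. For $p\in(0,1)^N$ its mass function is $\prod_i w_i^{\zeta_i}/R(z,S)$ for $\sum_i\zeta_i=z$, where $R(k,A)=\sum_{B\subseteq A,|B|=k}\prod_{l\in B}w_l$ with $R(0,A)=1$ and $R(k,A)=0$ for $k<0$ or $k>|A|$. For $p\in[0,1]^N$, with $O=\{i:p_i=0\}$, $I=\{i:p_i=1\}$, $V=S\setminus(I\cup O)$, it equals $\prod_{j\in V}w_j^{\zeta_j}/R(z-|I|,V)$ if $\zeta_j=p_j$ for all $j\in I\cup O$ and $\sum_{j\in V}\zeta_j=z-|I|$, and $0$ otherwise. Expectations and variances are with respect to $\zeta\sim\mathbb P(\zeta\mid Z=z)$ at the given $p$ (so only $\zeta$ with positive probability contribute); the total variance $\mathrm{var}(x)$ of a random vector is the sum of the variances of its entries. At boundary points derivatives are one-sided, and $\nabla_p\log\mathbb P=\nabla_p\mathbb P/\mathbb P$ where $\mathbb P>0$. *)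

(* Defs.v *)
From HB Require Import structures.
From mathcomp Require Export all_boot all_order all_algebra.
From mathcomp Require Export all_classical all_reals all_analysis.
Export Order.TTheory GRing.Theory Num.Theory.
Export numFieldNormedType.Exports.

Set Implicit Arguments.
Unset Strict Implicit.
Unset Printing Implicit Defensive.

Local Open Scope classical_set_scope.
Local Open Scope ring_scope.

Section CondBernoulli.
Context {R : realType} {N : nat}.
Implicit Types (p : 'rV[R]_N) (zeta : {ffun 'I_N -> bool}) (z : nat).

Definition weight p (i : 'I_N) : R := p 0 i / (1 - p 0 i).

Definition nb_ones zeta : nat := (\sum_(i < N) zeta i)%N.

Definition bern_pmf p zeta : R := \prod_(i < N) bernoulli_pmf (p 0 i) (zeta i).

Definition prob_sum p z : R := \sum_(zeta | nb_ones zeta == z) bern_pmf p zeta.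

(* Conditional probability of zeta given Z = z, as a function of p; the parameter
   comes last so that [cond_bern z zeta] can be differentiated. *)
Definition cond_bern z zeta p : R :=
  if nb_ones zeta == z then bern_pmf p zeta / prob_sum p z else 0.

Definition log_cond_bern z zeta p : R := ln (cond_bern z zeta p).

(* Expectation under the conditional law: every zeta of zero probability
   contributes 0, whatever the value of X there. *)
Definition cond_expect z p (X : {ffun 'I_N -> bool} -> R) : R :=
  \sum_zeta cond_bern z zeta p * X zeta.

Definition cond_var z p (X : {ffun 'I_N -> bool} -> R) : R :=
  cond_expect z p (fun zeta => (X zeta - cond_expect z p X) ^+ 2).

Definition total_var z p (X : {ffun 'I_N -> bool} -> 'rV[R]_N) : R :=
  \sum_(i < N) cond_var z p (fun zeta => X zeta 0 i).

(* Squared Euclidean norm; the library norm on 'rV[R]_N is the sup norm. *)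
Definition sqnorm (v : 'rV[R]_N) : R := \sum_(i < N) v 0 i ^+ 2.

Definition evec (i : 'I_N) : 'rV[R]_N := delta_mx 0 i.

Definition grad (f : 'rV[R]_N -> R) p : 'rV[R]_N :=
  \row_(i < N) 'D_(evec i) f p.

(* All summands are positive on the open cube, so the default value 0 of the
   iterated maximum is irrelevant there. *)
Definition weight_const p : R :=
  \big[Num.max/0]_(i < N) ((1 + weight p i) ^+ 2 / weight p i).

Definition open_cube : set 'rV[R]_N := [set p | forall i, 0 < p 0 i < 1].
Definition cube : set 'rV[R]_N := [set p | forall i, 0 <= p 0 i <= 1].

(* Directional derivative relative to the cube: the library's [derive] and
   [derivable] with the increments restricted to those that stay in the cube.
   Along [evec i] this is the right (left) derivative where p_i = 0 (p_i = 1), and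
   the two-sided derivative where 0 < p_i < 1. *)
Definition cube_incr p (v : 'rV[R]_N) : set R := [set h | cube (h *: v + p)].

Definition cube_derive (f : 'rV[R]_N -> R) p v : R :=
  lim ((fun h : R => h^-1 *: ((f \o shift p) (h *: v) - f p))
         @ within (cube_incr p v) 0^').

Definition cube_derivable (f : 'rV[R]_N -> R) p v : Prop :=
  cvg ((fun h : R => h^-1 *: ((f \o shift p) (h *: v) - f p))
         @ within (cube_incr p v) 0^').

Definition cube_grad (f : 'rV[R]_N -> R) p : 'rV[R]_N :=
  \row_(i < N) cube_derive f p (evec i).

End CondBernoulli.

(* Main.v *)
(** Both the unnormalised mass function [f] of [zeta] and the normalising
    constant [g] are affine in every coordinate of [p], so along a coordinate
    line [f / g] and its first partial derivatives are rational functions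
    without pole near the base point.  Ordinary and one-sided derivatives are
    thus limits of the same difference quotient along two different filters;
    in (b) nothing more is needed, as only finitely many finite numbers have to
    be bounded.  In the open cube, writing [P = f / g], [a_i = 1/(p_i(1-p_i))]
    and [pi_i] for the conditional mean of [zeta_i], one gets
    [d_i log P = a_i (zeta_i - pi_i)], a centred variable, and, for [i <> j],
    [d_i d_j P = P a_i a_j ((zeta_i - pi_i)(zeta_j - pi_j) - cov(zeta_i, zeta_j))],
    [d_i^2 P = - 2 P a_i^2 (zeta_i - pi_i)(pi_i - p_i)].
    The bounds follow because [a_i = (1 + w_i)^2 / w_i <= C]. *)

From mathcomp Require Import ring lra.
Require Import Defs.

Set Implicit Arguments.
Unset Strict Implicit.
Unset Printing Implicit Defensive.

Local Open Scope classical_set_scope.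
Local Open Scope ring_scope.

(** * Difference quotients along a filter of increments *)

Section Slopes.
Context {R : realType}.

Lemma is_derive_affine (x a b : R) : is_derive x 1 (fun h => a + h * b) b.
Proof.
rewrite [X in is_derive _ _ X _](_ : _ = cst a + b \*: id); last first.
  by apply/funext => h; rewrite /= mulrC.
by apply: is_derive_eq; rewrite add0r /GRing.scale /= mulr1.
Qed.

Lemma is_derive_quotient (u v : R -> R) (x du dv : R) : v x != 0 ->
  is_derive x 1 u du -> is_derive x 1 v dv ->
  is_derive x 1 (fun h => u h / v h) ((du * v x - u x * dv) / v x ^+ 2).
Proof.
move=> v0 hu hv; have hV := is_deriveV v0 hv.
apply: (is_derive_eq (is_deriveM hu hV)).
by rewrite /GRing.scale /=; field.
Qed.

Lemma is_derive_mul (u v : R -> R) (x du dv : R) :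
  is_derive x 1 u du -> is_derive x 1 v dv ->
  is_derive x 1 (fun h => u h * v h) (du * v x + u x * dv).
Proof.
move=> hu hv; apply: (is_derive_eq (is_deriveM hu hv)).
by rewrite /GRing.scale /= addrC [v x * _]mulrC.
Qed.

Lemma is_derive_sub (u v : R -> R) (x du dv : R) :
  is_derive x 1 u du -> is_derive x 1 v dv ->
  is_derive x 1 (fun h => u h - v h) (du - dv).
Proof. by move=> hu hv; exact: is_deriveB. Qed.

Lemma near0_affine_neq0 (a b : R) : a != 0 ->
  \forall h \near (0 : R), a + h * b != 0.
Proof.
move=> a0; have : {for (0 : R), continuous (fun h : R => a + h * b)}.
  apply/differentiable_continuous/derivable1_diffP.
  exact: (@ex_derive _ _ _ _ _ _ _ (is_derive_affine 0 a b)).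
move/cvgr_neq0 => /=; rewrite mul0r addr0; exact.
Qed.

Context {N : nat}.
Implicit Types (p v : 'rV[R]_N) (F : 'rV[R]_N -> R) (D : set R).

(** The quotient common to [derive] and [cube_derive]: taken along [within D 0^'], it gives the
    former for [D = setT] and the latter for [D = cube_incr p v]. *)
Definition slope F p v (h : R) : R := h^-1 *: ((F \o shift p) (h *: v) - F p).

(** Reduction to one real variable: [F] has to agree with a differentiable [phi] only along the
    admissible increments, so the two-sided derivative of [phi] serves one-sided limits too. *)
Lemma slope_cvg F p v D (phi : R -> R) (l : R) :
  is_derive (0 : R) 1 phi l ->
  (\forall h \near within D 0^', F (h *: v + p) = phi h) -> F p = phi 0 ->
  slope F p v @ within D 0^' --> l.
Proof.
move=> [dphi Dphi] Fphi F0.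
have cphi : (fun h : R => h^-1 *: ((phi \o shift 0) (h *: 1) - phi 0)) @ 0^' --> l.
  by rewrite -Dphi; exact: dphi.
apply: cvg_trans (cvg_trans (cvg_app _ (@cvg_within _ _ _ D)) cphi).
apply: near_eq_cvg; near=> h.
rewrite /slope /= addr0 -F0 /GRing.scale /= mulr1; congr (_ * (_ - _)).
by symmetry; near: h.
Unshelve. all: by end_near. Qed.

Lemma slope_setT_is_derive F p v (l : R) :
  slope F p v @ within setT 0^' --> l -> is_derive p v F l.
Proof.
rewrite withinET => Fl; apply: DeriveDef.
  by apply/cvg_ex; exists l.
exact: (cvg_lim (@Rhausdorff R) Fl).
Qed.

(** Properness makes limits along this filter unique, so that [lim] in [cube_derive] can be
    evaluated. It holds because an edge direction always leaves room inside the cube on at least one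
    side. *)
Lemma cube_incr_proper p i : cube p ->
  ProperFilter (within (cube_incr p (evec i)) 0^').
Proof.
move=> cp; apply: Build_ProperFilter_ex => P.
rewrite /within /dnbhs /within /= => /nbhs_ballP[e /= e0 He].
have [t [t0 te ct]] : exists t : R, [/\ t != 0, `|t| < e & cube (t *: evec i + p)].
  have /andP[p0 p1] := cp i.
  pose m : R := Num.min (e / 2) (1/2).
  have m0 : 0 < m by rewrite /m lt_min !divr_gt0.
  have e2 : e / 2 < e by rewrite ltr_pdivrMr // ltr_pMr // ltr1n.
  have [m1 m2] : m <= e / 2 /\ m <= 1/2 by rewrite /m; split; rewrite ge_min lexx ?orbT.
  (* Moving towards the far end by at most 1/2 keeps the coordinate in [0,1]; the cap [e / 2] keeps
     it inside the ball. *)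
  exists (if p 0 i < 1/2 then m else - m); split.
  - by case: ifP; rewrite ?oppr_eq0 gt_eqF.
  - by case: ifP; rewrite ?normrN gtr0_norm // (le_lt_trans m1).
  - move=> k; rewrite !mxE eqxx /=; have [->|ki] := eqVneq k i; last first.
      by rewrite mulr0 add0r; exact: cp.
    rewrite mulr1; case: ltP; lra.
exists t; apply: He => //=.
by rewrite /ball /= sub0r normrN.
Qed.

Lemma slope_cube_derivable F p v (l : R) :
  slope F p v @ within (cube_incr p v) 0^' --> l -> cube_derivable F p v.
Proof. by move=> Fl; apply/cvg_ex; exists l. Qed.

Lemma slope_cube_derive F p i (l : R) : cube p ->
  slope F p (evec i) @ within (cube_incr p (evec i)) 0^' --> l ->
  cube_derive F p (evec i) = l.
Proof.
move=> cp Fl; have := cube_incr_proper i cp => FF.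
exact: (cvg_lim (@Rhausdorff R) Fl).
Qed.

End Slopes.

(** * Quotients of coordinate-affine functions *)

Section CoordAffine.
Context {R : realType} {N : nat}.
Implicit Types (p : 'rV[R]_N) (f g : 'rV[R]_N -> R) (i j : 'I_N).

(* On coordinate-affine functions this difference is the [i]-th partial
   derivative, defined without limits and valid also on the faces of the cube. *)
Definition incr i f p : R := f (evec i + p) - f p.

Definition coord_affine f : Prop :=
  forall i p (h : R), f (h *: evec i + p) = f p + h * incr i f p.

Lemma coord_affine_incr f j : coord_affine f -> coord_affine (incr j f).
Proof.
move=> af i p h; rewrite /incr addrCA !af /incr addrCA; ring.
Qed.

Lemma incr_incr f i : coord_affine f -> forall p, incr i (incr i f) p = 0.
Proof.
move=> af p; rewrite /incr.
(* The value two steps away, read off affinely with [h = 2], is compared with two successive unit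
   steps. *)
have := af i p 2; rewrite scaler_nat mulr2n -addrA => ->; rewrite /incr; ring.
Qed.

(** The quotient rule for [f / g] with increments in place of partials; [quotient_deriv2] is the
    same rule applied once more, in direction [i]. *)
Definition quotient_deriv j f g p : R :=
  (incr j f p * g p - f p * incr j g p) / g p ^+ 2.

Definition quotient_deriv2 i j f g p : R :=
  ((incr i (incr j f) p * g p + incr j f p * incr i g p
    - incr i f p * incr j g p - f p * incr i (incr j g) p) * g p ^+ 2
   - (incr j f p * g p - f p * incr j g p) * (2 * g p * incr i g p))
  / (g p ^+ 2) ^+ 2.

Context (f g : 'rV[R]_N -> R).
Hypothesis (af : coord_affine f) (ag : coord_affine g).

Let line f i p h := f p + h * incr i f p.

Lemma line0 f' i p : line f' i p 0 = f' p.
Proof. by rewrite /line mul0r addr0. Qed.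

Lemma is_derive_quotient_line i p : g p != 0 ->
  is_derive (0 : R) 1 (fun h => line f i p h / line g i p h)
    (quotient_deriv i f g p).
Proof.
move=> gp; have := is_derive_quotient _ (is_derive_affine 0 (f p) (incr i f p))
  (is_derive_affine 0 (g p) (incr i g p)).
by rewrite !mul0r !addr0 => /(_ gp).
Qed.

Lemma slope_quotient D i p : g p != 0 ->
  slope (fun q => f q / g q) p (evec i) @ within D 0^'
    --> quotient_deriv i f g p.
Proof.
move=> gp; apply: (slope_cvg (is_derive_quotient_line i gp)).
  by near=> h; rewrite af ag.
by rewrite !line0.
Unshelve. all: by end_near. Qed.

Lemma slope_ln_quotient D i p : 0 < f p / g p ->
  slope (fun q => ln (f q / g q)) p (evec i) @ within D 0^'
    --> quotient_deriv i f g p / (f p / g p).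
Proof.
move=> fg0; have gp : g p != 0.
  by apply: contraTneq fg0 => ->; rewrite invr0 mulr0 ltxx.
apply: (@slope_cvg _ _ _ _ _ _ (fun h => ln (line f i p h / line g i p h))).
- have H := is_derive_quotient_line i gp.
  rewrite mulrC; apply: (is_derive1_comp _ H) => /=.
  by rewrite !line0; exact: is_derive1_ln.
- by near=> h; rewrite af ag.
- by rewrite !line0.
Unshelve. all: by end_near. Qed.

(** [G] stands for a first partial, ordinary or one-sided; its closed form is asked for only at [p]
    and near [p] along the filter, since the formula is available only where [g] does not vanish. *)
Lemma slope_quotient_deriv D (G : 'rV[R]_N -> R) i j p : g p != 0 ->
  (\forall h \near within D 0^',
     G (h *: evec i + p) = quotient_deriv j f g (h *: evec i + p)) ->
  G p = quotient_deriv j f g p ->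
  slope G p (evec i) @ within D 0^' --> quotient_deriv2 i j f g p.
Proof.
move=> gp nG Gp.
(* Increments of coordinate-affine functions are again coordinate-affine, so all four ingredients of
   the first partial are affine along the line. *)
pose phi h := (line (incr j f) i p h * line g i p h
   - line f i p h * line (incr j g) i p h) / (line g i p h * line g i p h).
have Hphi : is_derive (0 : R) 1 phi (quotient_deriv2 i j f g p).
  have L f' : is_derive (0 : R) 1 (line f' i p) (incr i f' p).
    exact: is_derive_affine.
  have v0 : line g i p 0 * line g i p 0 != 0 by rewrite line0 mulf_neq0.
  have Hphi := is_derive_quotient
    (v := fun h => line g i p h * line g i p h) v0
    (is_derive_sub (is_derive_mul (L (incr j f)) (L g))
      (is_derive_mul (L f) (L (incr j g))))
    (is_derive_mul (L g) (L g)).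
  apply: (is_derive_eq Hphi).
  rewrite !line0 /quotient_deriv2; field; exact: gp.
apply: (slope_cvg Hphi).
- near=> h; rewrite (near nG h) // /quotient_deriv /phi expr2 /line.
  rewrite (coord_affine_incr j af) (coord_affine_incr j ag) (af i p h) (ag i p h).
  by [].
- by rewrite Gp /phi !line0 /quotient_deriv expr2.
Unshelve. all: by end_near. Qed.

End CoordAffine.

Lemma ler_term_sum (R : numDomainType) (I : finType) (F : I -> R) i :
  (forall k, 0 <= F k) -> F i <= \sum_k F k.
Proof. by move=> F0; rewrite (bigD1 i) //= lerDl sumr_ge0. Qed.

(** * The conditional law and its derivatives, ordinary and one-sided *)

Section ConditionalBernoulli.
Context {R : realType} {N : nat}.
Implicit Types (p q : 'rV[R]_N) (zeta : {ffun 'I_N -> bool}) (i j : 'I_N) (z : nat).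

Lemma bern_pmf_coord_affine zeta :
  coord_affine (fun p : 'rV[R]_N => bern_pmf p zeta).
Proof.
move=> i p h; rewrite /incr -[evec i in RHS]scale1r.
pose rest := \prod_(k < N | k != i) bernoulli_pmf (p 0 k) (zeta k).
(* Only the factor at [i] sees the shift. The values for [c = 0], [1] and [h] share [rest], which
   leaves an identity between affine functions of one variable. *)
have split_at c : bern_pmf (c *: evec i + p) zeta =
    bernoulli_pmf (c + p 0 i) (zeta i) * rest.
  rewrite /bern_pmf (bigD1 i) //= !mxE !eqxx mulr1; congr (_ * _).
  by apply: eq_bigr => k ki; rewrite !mxE (negbTE ki) mulr0 add0r.
have := split_at 0; rewrite scale0r !add0r => ->; rewrite !split_at.
by rewrite /bernoulli_pmf; case: (zeta i); ring.
Qed.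

Lemma prob_sum_coord_affine z : coord_affine (fun p : 'rV[R]_N => prob_sum p z).
Proof.
move=> i p h; rewrite /incr /prob_sum -sumrB mulr_sumr -big_split /=.
by apply: eq_bigr => zeta _; rewrite bern_pmf_coord_affine.
Qed.

Lemma cond_bernE z zeta : nb_ones zeta = z ->
  cond_bern z zeta = fun q : 'rV[R]_N => bern_pmf q zeta / prob_sum q z.
Proof. by move=> hz; apply/funext => q; rewrite /cond_bern hz eqxx. Qed.

Definition dcond_bern z zeta i p : R :=
  quotient_deriv i (bern_pmf^~ zeta) (prob_sum^~ z) p.

Definition d2cond_bern z zeta i j p : R :=
  quotient_deriv2 i j (bern_pmf^~ zeta) (prob_sum^~ z) p.

(** Second derivatives need the formula for the first ones at nearby points too, hence a normalising
    constant that stays nonzero there. *)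
Lemma near_prob_sum_neq0 z D i p : prob_sum p z != 0 ->
  \forall h \near within D 0^', prob_sum (h *: evec i + p) z != 0.
Proof.
move=> g0; apply: cvg_within; apply: nbhs_dnbhs.
have H := near0_affine_neq0 (incr i (fun q : 'rV[R]_N => prob_sum q z) p) g0.
by near=> h; rewrite prob_sum_coord_affine; near: h.
Unshelve. all: by end_near. Qed.

Section FixedOutcome.
Context (z : nat) (zeta : {ffun 'I_N -> bool}).
Hypothesis hz : nb_ones zeta = z.

Let fA := bern_pmf_coord_affine zeta.
Let gA := prob_sum_coord_affine z.

Lemma slope_cond_bern D i p : prob_sum p z != 0 ->
  slope (cond_bern z zeta) p (evec i) @ within D 0^' --> dcond_bern z zeta i p.
Proof. by move=> g0; rewrite (cond_bernE hz); exact: slope_quotient. Qed.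

Lemma slope_log_cond_bern D i p : 0 < cond_bern z zeta p ->
  slope (log_cond_bern z zeta) p (evec i) @ within D 0^'
    --> dcond_bern z zeta i p / cond_bern z zeta p.
Proof.
rewrite /log_cond_bern (cond_bernE hz) => fg0; exact: slope_ln_quotient.
Qed.

Lemma is_derive_cond_bern i p : prob_sum p z != 0 ->
  is_derive p (evec i) (cond_bern z zeta) (dcond_bern z zeta i p).
Proof. by move=> g0; apply: slope_setT_is_derive; exact: slope_cond_bern. Qed.

Lemma is_derive_log_cond_bern i p : 0 < cond_bern z zeta p ->
  is_derive p (evec i) (log_cond_bern z zeta)
    (dcond_bern z zeta i p / cond_bern z zeta p).
Proof. by move=> g0; apply: slope_setT_is_derive; exact: slope_log_cond_bern. Qed.

Lemma is_derive2_cond_bern i j p : prob_sum p z != 0 ->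
  is_derive p (evec i) ('D_(evec j) (cond_bern z zeta))
    (d2cond_bern z zeta i j p).
Proof.
move=> g0; apply: slope_setT_is_derive; apply: slope_quotient_deriv => //.
  have ng := near_prob_sum_neq0 setT i g0.
  near=> h; have gh : prob_sum (h *: evec i + p) z != 0 by near: h.
  by rewrite (derive_val (is_derive := is_derive_cond_bern j gh)).
by rewrite (derive_val (is_derive := is_derive_cond_bern j g0)).
Unshelve. all: by end_near. Qed.

Lemma cube_derive_cond_bern i p : cube p -> prob_sum p z != 0 ->
  cube_derive (cond_bern z zeta) p (evec i) = dcond_bern z zeta i p.
Proof. by move=> cp g0; apply: slope_cube_derive => //; exact: slope_cond_bern. Qed.

Lemma cube_derivable2_cond_bern i j p : cube p -> prob_sum p z != 0 ->
  cube_derivable (fun q => cube_derive (cond_bern z zeta) q (evec j)) p (evec i).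
Proof.
move=> cp g0; apply: (@slope_cube_derivable _ _ _ _ _ (d2cond_bern z zeta i j p)).
apply: slope_quotient_deriv => //; last exact: cube_derive_cond_bern.
have ng := near_prob_sum_neq0 (cube_incr p (evec i)) i g0.
near=> h; apply: cube_derive_cond_bern; last by near: h.
(* The filter itself restricts to increments whose endpoint lies in the cube. *)
by near: h; exact: withinT.
Unshelve. all: by end_near. Qed.

End FixedOutcome.

Lemma closed_cube_bounds z p : cube p -> 0 < prob_sum p z ->
  (forall zeta, nb_ones zeta = z ->
     [/\ forall i, cube_derivable (cond_bern z zeta) p (evec i),
         0 < cond_bern z zeta p ->
           forall i, cube_derivable (log_cond_bern z zeta) p (evec i) &
         forall i j, cube_derivable
           (fun q => cube_derive (cond_bern z zeta) q (evec j)) p (evec i)])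
  /\
  exists Chat : R,
    cond_expect z p (fun zeta => sqnorm (cube_grad (log_cond_bern z zeta) p))
      <= Chat
    /\
    forall zeta, nb_ones zeta = z ->
      sqnorm (cube_grad (cond_bern z zeta) p) <= Chat
      /\
      forall i j,
        `| cube_derive (fun q => cube_derive (cond_bern z zeta) q (evec j))
             p (evec i) | <= Chat.
Proof.
move=> cp g0; have gp := lt0r_neq0 g0; split.
  move=> zeta hz; split.
  - by move=> i; apply: slope_cube_derivable; exact: slope_cond_bern.
  - by move=> f0 i; apply: slope_cube_derivable; exact: slope_log_cond_bern.
  - by move=> i j; exact: cube_derivable2_cond_bern.
set E := cond_expect _ _ _.
pose G zeta := sqnorm (cube_grad (cond_bern z zeta) p).
pose H zeta i j := `|cube_derive
  (fun q => cube_derive (cond_bern z zeta) q (evec j)) p (evec i)|.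
have G0 zeta : 0 <= G zeta by apply: sumr_ge0 => i _; exact: sqr_ge0.
have H0 zeta i : 0 <= \sum_j H zeta i j by apply: sumr_ge0 => j _; exact: normr_ge0.
have H1 zeta : 0 <= \sum_i \sum_j H zeta i j by apply: sumr_ge0.
have SG : 0 <= \sum_zeta G zeta by apply: sumr_ge0.
have SH : 0 <= \sum_zeta \sum_i \sum_j H zeta i j by apply: sumr_ge0.
(* With [p] fixed, the sum of all quantities to be bounded will do; [|E|] replaces [E] so that every
   summand is nonnegative and each one is below the total. *)
exists (`|E| + \sum_zeta G zeta + \sum_zeta \sum_i \sum_j H zeta i j); split.
  by rewrite -addrA (le_trans (ler_norm _)) // lerDl addr_ge0.
move=> zeta _; split=> [|i j].
  apply: (@le_trans _ _ (\sum_zeta' G zeta')); first exact: (ler_term_sum (F := G)).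
  by rewrite addrAC lerDr addr_ge0.
apply: (@le_trans _ _ (\sum_zeta \sum_i \sum_j H zeta i j)); last first.
  by rewrite lerDr addr_ge0.
apply: le_trans (ler_term_sum zeta H1).
apply: le_trans (ler_term_sum i (H0 zeta)).
by apply: (ler_term_sum (F := H zeta i)) => k; exact: normr_ge0.
Qed.

End ConditionalBernoulli.

(** * Positivity and logarithmic derivatives in the open cube *)

Section OpenCube.
Context {R : realType} {N : nat}.
Implicit Types (p : 'rV[R]_N) (zeta : {ffun 'I_N -> bool}) (i j : 'I_N) (z : nat).

Lemma bern_pmf_gt0 p zeta : open_cube p -> 0 < bern_pmf p zeta.
Proof.
move=> op; apply: prodr_gt0 => i _; have /andP[p0 p1] := op i.
by rewrite /bernoulli_pmf; case: (zeta i); rewrite ?subr_gt0.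
Qed.

Lemma exists_nb_ones z : (z <= N)%N ->
  exists zeta : {ffun 'I_N -> bool}, nb_ones zeta = z.
Proof.
(* The outcome whose first [z] entries are ones. *)
move=> zN; exists [ffun i : 'I_N => (i < z)%N].
rewrite /nb_ones; under eq_bigr do rewrite ffunE.
rewrite -(big_mkord xpredT (fun k : nat => nat_of_bool (k < z)%N)).
rewrite (big_cat_nat (n := z)) //=.
rewrite big_nat_cond (eq_bigr (fun=> 1%N)); last by move=> k /andP[/andP[_ ->]].
rewrite -big_nat_cond sum_nat_const_nat subn0 muln1 big_nat_cond big1 ?addn0 //.
by move=> k /andP[/andP[zk _] _]; rewrite ltnNge zk.
Qed.

Lemma prob_sum_gt0 p z : open_cube p -> (z <= N)%N -> 0 < prob_sum p z.
Proof.
move=> op /exists_nb_ones[zeta hz]; rewrite /prob_sum (bigD1 zeta) /=; last exact/eqP.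
by rewrite ltr_wpDr ?bern_pmf_gt0 // sumr_ge0 // => *; exact/ltW/bern_pmf_gt0.
Qed.

(** The partial derivative of the log mass of independent Bernoulli entries: [1 / p_i] for a one and
    [- 1 / (1 - p_i)] for a zero. *)
Definition score p zeta i : R :=
  ((zeta i)%:R - p 0 i) / (p 0 i * (1 - p 0 i)).

Lemma incr_bern_pmf p zeta i : 0 < p 0 i < 1 ->
  incr i (fun q => bern_pmf q zeta) p = bern_pmf p zeta * score p zeta i.
Proof.
move=> /andP[p0 p1]; rewrite /incr /bern_pmf ![\prod_(k < N) _](bigD1 i) //=.
rewrite [X in _ * X - _](_ : _ =
    \prod_(k < N | k != i) bernoulli_pmf (p 0 k) (zeta k)); last first.
  by apply: eq_bigr => k ki; rewrite !mxE (negbTE ki) add0r.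
rewrite /score /bernoulli_pmf !mxE !eqxx; case: (zeta i) => /=; field; lra.
Qed.

(** The score at [j] ignores the coordinate [i]. The shifted point [evec i + p] leaves the open
    cube, but [incr_bern_pmf] constrains only the coordinate [j], which is unchanged. *)
Lemma incr2_bern_pmf p zeta i j : open_cube p -> i != j ->
  incr i (incr j (fun q => bern_pmf q zeta)) p =
  bern_pmf p zeta * (score p zeta i * score p zeta j).
Proof.
move=> op ij; rewrite {1}/incr.
have pj : (evec i + p) 0 j = p 0 j by rewrite !mxE eq_sym (negbTE ij) add0r.
rewrite !incr_bern_pmf ?pj //.
have -> : score (evec i + p) zeta j = score p zeta j by rewrite /score pj.
have := incr_bern_pmf zeta (op i); rewrite /incr => H.
by rewrite -mulrBl H mulrA.
Qed.

(** * Moments of the conditional law and the bounds of (a) *)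

Section Conditional.
Context (p : 'rV[R]_N) (z : nat).
Hypotheses (op : open_cube p) (zN : (z <= N)%N).

Let E := cond_expect z p.

Let g0 : 0 < prob_sum p z. Proof. exact: prob_sum_gt0. Qed.

Let gne := lt0r_neq0 g0.

Lemma cond_bern_ge0 zeta : 0 <= cond_bern z zeta p.
Proof.
by rewrite /cond_bern; case: ifP => // _; rewrite divr_ge0 // ltW // bern_pmf_gt0.
Qed.

Lemma cond_bern_gt0 zeta : nb_ones zeta = z -> 0 < cond_bern z zeta p.
Proof. by move=> hz; rewrite (cond_bernE hz) divr_gt0 // bern_pmf_gt0. Qed.

Lemma cond_expectE X : E X =
  (\sum_(zeta | nb_ones zeta == z) bern_pmf p zeta * X zeta) / prob_sum p z.
Proof.
rewrite /E /cond_expect mulr_suml [RHS]big_mkcond; apply: eq_bigr => zeta _.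
by rewrite /cond_bern; case: ifP => _; rewrite ?mul0r // mulrAC.
Qed.

Lemma cond_expect1 : E (fun=> 1) = 1.
Proof. by rewrite cond_expectE; under eq_bigr do rewrite mulr1; rewrite divff. Qed.

Lemma cond_expectD X Y : E (fun zeta => X zeta + Y zeta) = E X + E Y.
Proof.
by rewrite /E /cond_expect -big_split; apply: eq_bigr => *; rewrite mulrDr.
Qed.

Lemma cond_expectZ c X : E (fun zeta => c * X zeta) = c * E X.
Proof.
by rewrite /E /cond_expect mulr_sumr; apply: eq_bigr => *; rewrite mulrCA.
Qed.

Lemma cond_expect_cst c : E (fun=> c) = c.
Proof.
by have := cond_expectZ c (fun=> 1); rewrite mulr1 cond_expect1 mulr1.
Qed.

(** Lets formulas proved only on the event [Z = z] be substituted under the expectation, as the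
    conditional mass vanishes elsewhere. *)
Lemma eq_cond_expect X Y : (forall zeta, nb_ones zeta = z -> X zeta = Y zeta) ->
  E X = E Y.
Proof.
move=> XY; apply: eq_bigr => zeta _; rewrite /cond_bern.
by case: eqP => [/XY ->|]; rewrite ?mul0r.
Qed.

Lemma cond_expect_le X Y : (forall zeta, X zeta <= Y zeta) -> E X <= E Y.
Proof. by move=> XY; apply: ler_sum => *; rewrite ler_wpM2l // cond_bern_ge0. Qed.

Lemma cond_expect_unit X : (forall zeta, 0 <= X zeta <= 1) -> 0 <= E X <= 1.
Proof.
move=> X01; apply/andP; split.
  by rewrite -(cond_expect_cst 0) cond_expect_le // => zeta; case/andP: (X01 zeta).
rewrite -[leRHS](cond_expect_cst 1) cond_expect_le // => zeta.
by case/andP: (X01 zeta).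
Qed.

Lemma cond_bern_le1 zeta : cond_bern z zeta p <= 1.
Proof.
rewrite -cond_expect1 /E /cond_expect; under eq_bigr do rewrite mulr1.
exact: (ler_term_sum zeta cond_bern_ge0).
Qed.

(** Summing the increments of the masses shows that the logarithmic derivative of the normalising
    constant is the mean score. *)
Lemma incr_prob_sum i :
  incr i (fun q => prob_sum q z) p = prob_sum p z * E (fun zeta => score p zeta i).
Proof.
rewrite cond_expectE mulrC divfK // /incr /prob_sum -sumrB.
by apply: eq_bigr => zeta _; exact: incr_bern_pmf.
Qed.

Lemma incr2_prob_sum i j : i != j ->
  incr i (incr j (fun q => prob_sum q z)) p =
  prob_sum p z * E (fun zeta => score p zeta i * score p zeta j).
Proof.
move=> ij; rewrite cond_expectE mulrC divfK // /incr /prob_sum -!sumrB.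
by apply: eq_bigr => zeta _; exact: incr2_bern_pmf.
Qed.

(** First and second order inclusion probabilities; [inclusion i] is [pi_i] and [inv_bern_var i] is
    [a_i] in the overview. *)
Definition inclusion i : R := E (fun zeta => (zeta i)%:R).
Definition inclusion2 i j : R := E (fun zeta => (zeta i)%:R * (zeta j)%:R).
Definition inv_bern_var i : R := (p 0 i * (1 - p 0 i))^-1.

Lemma inclusion_unit i : 0 <= inclusion i <= 1.
Proof. by apply: cond_expect_unit => zeta; case: (zeta i); rewrite ?lexx ler01. Qed.

Lemma inclusion2_unit i j : 0 <= inclusion2 i j <= 1.
Proof.
apply: cond_expect_unit => zeta.
by case: (zeta i) (zeta j) => [] []; rewrite ?mulr0 ?mul0r ?mulr1 ?lexx ?ler01.
Qed.

Lemma cond_expect_affine a b X : E (fun zeta => a * X zeta + b) = a * E X + b.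
Proof. by rewrite cond_expectD cond_expectZ cond_expect_cst. Qed.

Lemma cond_expect_score i :
  E (fun zeta => score p zeta i) = inv_bern_var i * (inclusion i - p 0 i).
Proof.
rewrite mulrBr -mulrN -cond_expect_affine; apply: eq_cond_expect => zeta _.
by rewrite /score -/(inv_bern_var i) mulrC mulrBr mulrN.
Qed.

Lemma cond_expect_score2 i j :
  E (fun zeta => score p zeta i * score p zeta j) =
  inv_bern_var i * inv_bern_var j * (inclusion2 i j - p 0 j * inclusion i
    - p 0 i * inclusion j + p 0 i * p 0 j).
Proof.
pose c : R := p 0 i * p 0 j; pose a := inv_bern_var i * inv_bern_var j.
transitivity (E (fun zeta => a * ((zeta i)%:R * (zeta j)%:R
    + (- p 0 j * (zeta i)%:R + (- p 0 i * (zeta j)%:R + c))))).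
  apply: eq_cond_expect => zeta _.
  by rewrite /score -!/(inv_bern_var _) /a /c; ring.
rewrite cond_expectZ !cond_expectD !cond_expectZ cond_expect_cst.
by rewrite -/(inclusion i) -/(inclusion j) -/(inclusion2 i j) /a /c; ring.
Qed.

(** The logarithmic derivative of the quotient is the score minus its mean, where the shift by [p_i]
    cancels. *)
Lemma dcond_bern_score zeta i : nb_ones zeta = z ->
  dcond_bern z zeta i p =
  cond_bern z zeta p * (inv_bern_var i * ((zeta i)%:R - inclusion i)).
Proof.
move=> hz; rewrite /dcond_bern /quotient_deriv incr_bern_pmf // incr_prob_sum.
rewrite cond_expect_score (cond_bernE hz) /score -/(inv_bern_var i).
by field.
Qed.

(** The pure second increments of [f] and [g] vanish, so the quotient rule leaves
    [- 2 (d_i P) (d_i g) / g]. *)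
Lemma d2cond_bern_diag zeta i : nb_ones zeta = z ->
  d2cond_bern z zeta i i p = cond_bern z zeta p * inv_bern_var i ^+ 2
    * (- 2 * (((zeta i)%:R - inclusion i) * (inclusion i - p 0 i))).
Proof.
move=> hz; rewrite /d2cond_bern /quotient_deriv2.
rewrite (incr_incr _ (bern_pmf_coord_affine zeta)).
rewrite (incr_incr _ (prob_sum_coord_affine z)) incr_bern_pmf // incr_prob_sum.
rewrite cond_expect_score (cond_bernE hz) /score -/(inv_bern_var i).
by field.
Qed.

(** Divided by [P], the mixed derivative is the product of the centred scores minus their
    covariance; centring removes [p_i] and [p_j]. *)
Lemma d2cond_bern_offdiag zeta i j : nb_ones zeta = z -> i != j ->
  d2cond_bern z zeta i j p =
  cond_bern z zeta p * (inv_bern_var i * inv_bern_var j)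
    * (((zeta i)%:R - inclusion i) * ((zeta j)%:R - inclusion j)
       - (inclusion2 i j - inclusion i * inclusion j)).
Proof.
move=> hz ij; rewrite /d2cond_bern /quotient_deriv2.
rewrite incr2_bern_pmf // incr2_prob_sum // !incr_bern_pmf // !incr_prob_sum.
rewrite cond_expect_score2 !cond_expect_score (cond_bernE hz) /score.
rewrite -!/(inv_bern_var _).
by field.
Qed.

Lemma inv_bern_var_ge0 i : 0 <= inv_bern_var i.
Proof.
have /andP[p0 p1] := op i.
by rewrite /inv_bern_var invr_ge0 mulr_ge0 // ?subr_ge0 ltW.
Qed.

Lemma inv_bern_var_le i : inv_bern_var i <= weight_const p.
Proof.
have /andP[p0 p1] := op i.
suff -> : inv_bern_var i = (1 + weight p i) ^+ 2 / weight p i by exact: le_bigmax.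
by rewrite /inv_bern_var /weight; field; lra.
Qed.

Lemma inv_bern_varM_le i j :
  inv_bern_var i * inv_bern_var j <= weight_const p ^+ 2.
Proof. by rewrite expr2 ler_pM ?inv_bern_var_ge0 ?inv_bern_var_le. Qed.

Lemma normr_d2cond_bern_le zeta i j : nb_ones zeta = z ->
  `|d2cond_bern z zeta i j p| <= 2 * weight_const p ^+ 2.
Proof.
move=> hz.
(* Since [P] is at most 1 and [a_i a_j] at most [C ^+ 2], only the last factor remains to be
   bounded, by 2. *)
have step x y : `|x| <= 2 -> y = inv_bern_var i * inv_bern_var j ->
    `|cond_bern z zeta p * y * x| <= 2 * weight_const p ^+ 2.
  move=> x2 ->; rewrite -mulrA normrM (ger0_norm (cond_bern_ge0 _)).
  rewrite normrM ger0_norm ?mulr_ge0 ?inv_bern_var_ge0 // [2 * _]mulrC.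
  rewrite -[leRHS]mul1r ler_pM ?cond_bern_ge0 ?cond_bern_le1 //.
    by rewrite mulr_ge0 // mulr_ge0 ?inv_bern_var_ge0.
  by rewrite ler_pM ?inv_bern_varM_le // mulr_ge0 ?inv_bern_var_ge0.
have /andP[i0 i1] := inclusion_unit i; have /andP[j0 j1] := inclusion_unit j.
have /andP[p0 p1] := op i.
have [ij|ij] := eqVneq i j.
  rewrite -ij d2cond_bern_diag //; apply: step.
    rewrite ler_norml; case: (zeta i) => /=; apply/andP; split; nra.
  by rewrite expr2 {2}ij.
have /andP[m0 m1] := inclusion2_unit i j.
rewrite d2cond_bern_offdiag //; apply: step => //.
(* The product of centred indicators and the covariance are each at most 1 in modulus, because all
   three moments lie in [0,1]. *)
rewrite ler_norml; case: (zeta i) (zeta j) => [] [] /=; apply/andP; split; nra.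
Qed.

Lemma derive_log_cond_bern zeta i : nb_ones zeta = z ->
  'D_(evec i) (log_cond_bern z zeta) p =
  inv_bern_var i * ((zeta i)%:R - inclusion i).
Proof.
move=> hz; have c0 := cond_bern_gt0 hz.
rewrite (derive_val (is_derive := is_derive_log_cond_bern hz i c0)).
by rewrite dcond_bern_score // mulrC mulKf // gt_eqF.
Qed.

(** Entrywise, the gradient of [P] is [P] times that of [log P], and [P] lies in [0,1]. *)
Lemma sqnorm_grad_le zeta : nb_ones zeta = z ->
  sqnorm (grad (cond_bern z zeta) p) <= sqnorm (grad (log_cond_bern z zeta) p).
Proof.
move=> hz; apply: ler_sum => i _; rewrite !mxE derive_log_cond_bern //.
rewrite (derive_val (is_derive := is_derive_cond_bern hz i gne)).
rewrite dcond_bern_score // exprMn ler_piMl ?sqr_ge0 //.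
by rewrite exprn_ile1 ?cond_bern_ge0 ?cond_bern_le1.
Qed.

Lemma sqnorm_grad_log_le zeta : nb_ones zeta = z ->
  sqnorm (grad (log_cond_bern z zeta) p) <= N%:R * weight_const p ^+ 2.
Proof.
move=> hz; rewrite mulr_natl -[X in _ *+ X](card_ord N) -sumr_const.
apply: ler_sum => i _; rewrite mxE derive_log_cond_bern // exprMn.
have /andP[i0 i1] := inclusion_unit i.
rewrite -[leRHS]mulr1 ler_pM ?sqr_ge0 ?expr2 ?inv_bern_varM_le //.
by case: (zeta i) => /=; nra.
Qed.

Lemma cond_expect_grad_log i :
  E (fun zeta => grad (log_cond_bern z zeta) p 0 i) = 0.
Proof.
transitivity (E (fun zeta => inv_bern_var i * (zeta i)%:R
    + - (inv_bern_var i * inclusion i))).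
  by apply: eq_cond_expect => zeta hz; rewrite mxE derive_log_cond_bern // mulrBr.
by rewrite cond_expect_affine subrr.
Qed.

(** Each entry of the log-gradient has mean zero, so its second moment is its variance. *)
Lemma cond_expect_sqnorm_grad_log :
  E (fun zeta => sqnorm (grad (log_cond_bern z zeta) p))
    = total_var z p (fun zeta => grad (log_cond_bern z zeta) p).
Proof.
rewrite /total_var /E /cond_expect; under eq_bigr do rewrite mulr_sumr.
rewrite exchange_big; apply: eq_bigr => i _.
rewrite /cond_var -/E cond_expect_grad_log /E /cond_expect.
by apply: eq_bigr => zeta _; rewrite subr0.
Qed.

Lemma total_var_grad_log_le :
  total_var z p (fun zeta => grad (log_cond_bern z zeta) p)
    <= N%:R / 4 * weight_const p ^+ 2.
Proof.
rewrite -mulrA mulr_natl -[X in _ *+ X](card_ord N) -sumr_const.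
apply: ler_sum => i _; rewrite /cond_var -/E cond_expect_grad_log.
set m := inclusion i; set a := inv_bern_var i.
have -> : E (fun zeta => (grad (log_cond_bern z zeta) p 0 i - 0) ^+ 2)
    = a ^+ 2 * (m * (1 - m)).
  (* As [zeta_i] is 0 or 1, the square of [zeta_i - m] equals [(1 - 2 m) zeta_i + m ^+ 2], whose
     mean is [m (1 - m)]. *)
  transitivity (E (fun zeta => a ^+ 2 * (1 - 2 * m) * (zeta i)%:R
      + a ^+ 2 * m ^+ 2)).
    apply: eq_cond_expect => zeta hz; rewrite subr0 mxE derive_log_cond_bern //.
    by rewrite -/a -/m; case: (zeta i) => /=; ring.
  by rewrite cond_expect_affine -/(inclusion i) -/m; ring.
rewrite mulrC ler_pM ?sqr_ge0 //.
- by have /andP[m0 m1] := inclusion_unit i; rewrite mulr_ge0 // subr_ge0.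
(* Completing the square bounds the variance of an indicator by 1/4. *)
- rewrite -subr_ge0; have -> : 4^-1 - m * (1 - m) = (m - 2^-1) ^+ 2 by field.
  exact: sqr_ge0.
- by rewrite expr2 inv_bern_varM_le.
Qed.

End Conditional.
End OpenCube.

(** * Assembly of (a) and (b) *)

Theorem lemma4p1 (R : realType) (N z : nat) (hN : (1 <= N)%N) (hz : (z <= N)%N) :
  (* (a) *)
  (forall p : 'rV[R]_N, open_cube p ->
    let C := weight_const p in
    (forall zeta : {ffun 'I_N -> bool}, nb_ones zeta = z ->
       (* the derivatives exist *)
       [/\ forall i, derivable (cond_bern z zeta) p (evec i),
           forall i, derivable (log_cond_bern z zeta) p (evec i) &
           forall i j, derivable ('D_(evec j) (cond_bern z zeta)) p (evec i)]
       /\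
       [/\ sqnorm (grad (cond_bern z zeta) p)
             <= sqnorm (grad (log_cond_bern z zeta) p),
           sqnorm (grad (log_cond_bern z zeta) p) <= N%:R * C ^+ 2 &
           forall i j,
             `| 'D_(evec i) ('D_(evec j) (cond_bern z zeta)) p | <= 2 * C ^+ 2])
    /\
    cond_expect z p (fun zeta => sqnorm (grad (log_cond_bern z zeta) p))
      = total_var z p (fun zeta => grad (log_cond_bern z zeta) p)
    /\
    total_var z p (fun zeta => grad (log_cond_bern z zeta) p)
      <= N%:R / 4 * C ^+ 2)
  /\
  (* (b) *)
  (forall p : 'rV[R]_N, cube p -> 0 < prob_sum p z ->
    (* the one-sided derivatives exist *)
    (forall zeta : {ffun 'I_N -> bool}, nb_ones zeta = z ->
       [/\ forall i, cube_derivable (cond_bern z zeta) p (evec i),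
           0 < cond_bern z zeta p ->
             forall i, cube_derivable (log_cond_bern z zeta) p (evec i) &
           forall i j, cube_derivable
             (fun q => cube_derive (cond_bern z zeta) q (evec j)) p (evec i)])
    /\
    exists Chat : R,
      cond_expect z p (fun zeta => sqnorm (cube_grad (log_cond_bern z zeta) p))
        <= Chat
      /\
      forall zeta : {ffun 'I_N -> bool}, nb_ones zeta = z ->
        sqnorm (cube_grad (cond_bern z zeta) p) <= Chat
        /\
        forall i j,
          `| cube_derive (fun q => cube_derive (cond_bern z zeta) q (evec j))
               p (evec i) | <= Chat).
Proof.
split=> [p op C|p cp g0]; last exact: closed_cube_bounds.
have gp := lt0r_neq0 (prob_sum_gt0 op hz).
split; [|split].
- move=> zeta hzeta; split; split.
  + by move=> i; exact: (ex_derive (is_derive := is_derive_cond_bern hzeta i gp)).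
  + move=> i.
    exact: (ex_derive (is_derive :=
      is_derive_log_cond_bern hzeta i (cond_bern_gt0 op hz hzeta))).
  + by move=> i j; exact: (ex_derive (is_derive := is_derive2_cond_bern hzeta i j gp)).
  + exact: sqnorm_grad_le.
  + exact: sqnorm_grad_log_le.
  + move=> i j.
    rewrite (derive_val (is_derive := is_derive2_cond_bern hzeta i j gp)).
    exact: normr_d2cond_bern_le.
- exact: cond_expect_sqnorm_grad_log.
- exact: total_var_grad_log_le.
Qed.
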